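(* For any algorithm $\mathcal{A}$ and any $|S|>3$, $|A|\ge 1$, there exist an MDP $M$ (with deterministic transitions) with $|S|$ states and $|A|$ actions and a sequence of losses $\ell_1,\dots,\ell_T$ such that $$R(\mathcal{A})\ge\Omega\left(\sqrt{|S|\,T\log|A|}\right),$$ where $R(\mathcal{A})$ is the regret incurred by $\mathcal{A}$ on $M$ with the given sequence of losses.
   Context: An MDP with deterministic transitions consists of a finite state space $S$, a finite action space $A$, and a map $N:S\times A\to S$ giving the next state. Protocol: an oblivious adversary fixes in advance loss functions $\ell_1,\dots,\ell_T:S\times A\to[0,1]$. The interaction starts in some state $s_1\in S$. At each step $t=1,\dots,T$ the algorithm, in state $s_t$, chooses (possibly at random) an action $a_t$ depending on the current state and $\ell_1,\dots,\ell_{t-1}$; it incurs loss $\ell_t(s_t,a_t)$, the whole function $\ell_t$ is then revealed (full information), and $s_{t+1}=N(s_t,a_t)$. The dynamics are known to the algorithm. The regret is $R(\mathcal{A})=\mathbb{E}\left[\sum_{t=1}^T\ell_t(s_t,a_t)\right]-\min_\pi L^\pi$, where the minimum is over stationary deterministic policies $\pi:S\to A$ and $L^\pi$ is the total loss incurred over $T$ steps by following $\pi$ from $s_1$. The $\Omega(\cdot)$ is standard asymptotic notation in $T$ with an absolute constant: there is an absolute constant $c>0$ such that the bound with constant $c$ holds for all sufficiently large $T$ (depending on $|S|,|A|$). *)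

(* Defs.v *)
From HB Require Import structures.
From mathcomp Require Import all_boot all_order all_algebra.
From mathcomp Require Import all_classical all_reals all_analysis.

Set Implicit Arguments.
Unset Strict Implicit.
Unset Printing Implicit Defensive.

Import Order.TTheory GRing.Theory Num.Theory.
Import numFieldNormedType.Exports.

Local Open Scope classical_set_scope.
Local Open Scope ring_scope.

Definition det_mdp (S A : finType) := S -> A -> S.

(* The value at t is the loss function of step t.+1. *)
Definition loss_seq (R : realType) (S A : finType) := nat -> S -> A -> R.

(* [act N w h s] is the action chosen at step (size h).+1 in state s, where N
   is the known dynamics, h the list of loss functions revealed so far (oldest
   first) and w the internal randomness, drawn once before the interaction.
   Since w is available at every step, the choices at different steps may be
   arbitrarily correlated: as transitions are deterministic, this covers
   dependence on past states and actions too. *)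
Record algorithm (R : realType) (S A : finType) (d : measure_display)
    (Omega : measurableType d) := Algorithm {
  act :> det_mdp S A -> Omega -> seq (S -> A -> R) -> S -> A ;
  act_measurable : forall N h s a,
    measurable [set w | act N w h s = a] }.

Section Regret.
Context (R : realType) (S A : finType) (N : det_mdp S A) (s1 : S).

(* State occupied at step t.+1 when [choose u] is the decision rule of
   step u.+1. *)
Fixpoint state_at (choose : nat -> S -> A) (t : nat) : S :=
  if t is u.+1 then
    let s := state_at choose u in N s (choose u s)
  else s1.

Definition total_loss (loss : loss_seq R S A) (choose : nat -> S -> A)
    (T : nat) : R :=
  \sum_(t < T) loss t (state_at choose t) (choose t (state_at choose t)).

Definition policy_loss (loss : loss_seq R S A) (T : nat)
    (pi : {ffun S -> A}) : R :=
  total_loss loss (fun=> pi) T.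

Definition algorithm_loss (d : measure_display) (Omega : measurableType d)
    (alg : algorithm R S A Omega) (loss : loss_seq R S A) (T : nat)
    (w : Omega) : R :=
  total_loss loss (fun t => alg N w (mkseq loss t)) T.

(* The minimum is taken in the extended reals only so that +oo can serve as
   the neutral element of min. *)
Definition regret (d : measure_display) (Omega : measurableType d)
    (P : probability Omega R) (alg : algorithm R S A Omega)
    (loss : loss_seq R S A) (T : nat) : \bar R :=
  ('E_P[algorithm_loss alg loss T] -
   \big[Order.min/+oo]_(pi : {ffun S -> A}) (policy_loss loss T pi)%:E)%E.

End Regret.

(* Main.v *)
(* The transitions run through all the states in a fixed cycle, whatever the
   actions, so each state s is visited about T/|S| times.  Put
   k = floor (log2 |A|) and label actions by bit strings of length k, all of
   which occur.  Successive rounds through the cycle charge the bits 1, ..., k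
   in turn: the loss at step t is the xor of the charged bit of the action with
   a fair coin x_t.  Every algorithm has mean loss T/2, because flipping x_t
   changes neither the history nor the action at step t.  In hindsight the bits
   can be chosen separately for each pair (state, bit), which gains half of the
   absolute value of a simple random walk of about T/(|S|k) steps.  By
   Khinchine's inequality the mean regret is at least of order
   |S| k sqrt (T/(|S|k)) = sqrt (|S| T k), so some outcome of the coins has at
   least that regret. *)
Require Import Defs.
From HB Require Import structures.
From mathcomp Require Import all_boot all_order all_algebra.
From mathcomp Require Import all_classical all_reals all_analysis.
From mathcomp Require Import ring lra zify.
Set Implicit Arguments.
Unset Strict Implicit.
Unset Printing Implicit Defensive.
Import Order.TTheory GRing.Theory Num.Theory.
Import numFieldNormedType.Exports.

Local Open Scope classical_set_scope.
Local Open Scope ring_scope.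

(** * Fair coins: sign symmetry and moments of the random walk *)

Definition flip (I : finType) (i : I) (s : {ffun I -> bool}) :=
  [ffun j => s j (+) (j == i)].

Lemma flipK (I : finType) (i : I) : involutive (flip i).
Proof. by move=> s; apply/ffunP => j; rewrite !ffunE addbK. Qed.

Lemma flip_neq (I : finType) (i j : I) (s : {ffun I -> bool}) :
  j != i -> flip i s j = s j.
Proof. by move=> /negPf ji; rewrite ffunE ji addbF. Qed.

Section Coins.
Variables (R : rcfType) (I : finType).
Implicit Types (s : {ffun I -> bool}) (B : {set I}).

(** The involution [flip i] sends each term to its opposite. *)
Lemma sum_sign_flip (i : I) (h : {ffun I -> bool} -> R) :
  (forall s, h (flip i s) = h s) -> \sum_(s : {ffun I -> bool}) (-1) ^+ s i * h s = 0.
Proof.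
move=> hi; set X := \sum_s _.
suff : X = - X by lra.
rewrite {1}/X (reindex_inj (inv_inj (flipK i))) -sumrN; apply: eq_bigr => s _.
by rewrite hi ffunE eqxx addbT signrN mulNr.
Qed.

Definition walk B s : R := \sum_(i in B) (-1) ^+ s i.

Lemma walk_flip B i s : i \notin B -> walk B (flip i s) = walk B s.
Proof.
move=> iB; apply: eq_bigr => j jB; rewrite flip_neq //.
by apply: contraNneq iB => <-.
Qed.

Lemma walkU1 B i s : i \notin B -> walk (i |: B) s = (-1) ^+ s i + walk B s.
Proof. exact: big_setU1. Qed.

Lemma sum_coins1 : \sum_(s : {ffun I -> bool}) 1 = 2 ^+ #|I| :> R.
Proof. by rewrite sumr_const card_ffun card_bool natrX. Qed.

(** Induction removing one coin [i]: the cross term is odd in its sign, hence sums to zero. *)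
Lemma walk_sqr B :
  \sum_(s : {ffun I -> bool}) walk B s ^+ 2 = 2 ^+ #|I| * #|B|%:R.
Proof.
have [n] := ubnP #|B|; elim: n B => // n IHn B.
have [->|[i iB]] := set_0Vmem B => Bn.
  by rewrite cards0 mulr0 big1 // => s _; rewrite /walk big_set0 expr0n.
have iB' : i \notin B :\ i by rewrite setD11.
move: Bn; rewrite -(finset.setD1K iB); move: (B :\ i) iB' => C iC.
rewrite cardsU1 iC add1n ltnS => /IHn{}IHn.
rewrite (eq_bigr (fun s => walk C s ^+ 2 + 1 + (-1) ^+ s i * (2 * walk C s))).
  rewrite !big_split /= IHn sum_coins1 sum_sign_flip ?addr0; last first.
    by move=> s; rewrite walk_flip.
  by rewrite -natr1; ring.
move=> s _; rewrite walkU1 // sqrrD sqrr_sign; ring.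
Qed.

(** Same induction: for [C] of cardinal n, the even terms give at most 3 n^2 + 6 n + 1 <= 3 (n +
    1)^2. *)
Lemma walk_pow4 B : \sum_(s : {ffun I -> bool}) walk B s ^+ 4 <= 2 ^+ #|I| * (3 * #|B|%:R ^+ 2).
Proof.
have [n] := ubnP #|B|; elim: n B => // n IHn B.
have [->|[i iB]] := set_0Vmem B => Bn.
  by rewrite cards0 expr0n !mulr0 big1 // => s _; rewrite /walk big_set0 expr0n.
have iB' : i \notin B :\ i by rewrite setD11.
move: Bn; rewrite -(finset.setD1K iB); move: (B :\ i) iB' => C iC.
rewrite cardsU1 iC add1n ltnS => /IHn{}IHn.
rewrite (eq_bigr (fun s => walk C s ^+ 4 + 6 * walk C s ^+ 2 + 1 +
    (-1) ^+ s i * (4 * walk C s + 4 * walk C s ^+ 3))).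
  rewrite !big_split /= -mulr_sumr walk_sqr sum_coins1 sum_sign_flip; last first.
    by move=> s; rewrite walk_flip.
  have : 0 <= 2 ^+ #|I| :> R by rewrite exprn_ge0.
  rewrite -natr1; nra.
move=> s _; rewrite walkU1 //; case: (s i); rewrite ?expr1 ?expr0; ring.
Qed.

(* Fourth-moment method: [u - 3/2 u^2 + 1/2 u^4 = u (u - 1)^2 (u + 2) / 2] is
   nonnegative for [u >= 0]; it is used at [u = |walk B s| / (2 r)]. *)
Lemma khinchine_L1 B :
  2 ^+ #|I| * (2^-1 * Num.sqrt #|B|%:R) <= \sum_(s : {ffun I -> bool}) `|walk B s|.
Proof.
have [/eqP|B0] := posnP #|B|.
  by rewrite cards_eq0 => /eqP ->; rewrite cards0 sqrtr0 !mulr0 sumr_ge0.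
set r : R := Num.sqrt _.
have r0 : 0 < r by rewrite sqrtr_gt0 ltr0n.
have rE : #|B|%:R = r ^+ 2 by rewrite sqr_sqrtr.
have absE (x : R) : 3 / (4 * r) * x ^+ 2 - x ^+ 4 / (16 * r ^+ 3) <= `|x|.
  have -> : x ^+ 2 = `|x| ^+ 2 by rewrite real_normK ?num_real.
  have -> : x ^+ 4 = `|x| ^+ 4 by rewrite -normrX ger0_norm // exprn_even_ge0.
  have y0 : 0 <= `|x| :> R by rewrite normr_ge0.
  set y : R := `|x| in y0 *; rewrite -subr_ge0.
  have -> : y - (3 / (4 * r) * y ^+ 2 - y ^+ 4 / (16 * r ^+ 3)) =
    y * (y - 2 * r) ^+ 2 * (y + 4 * r) / (16 * r ^+ 3).
    by field; rewrite gt_eqF.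
  have r_ge0 := ltW r0.
  rewrite divr_ge0 ?[0 <= 16 * _]mulr_ge0 ?exprn_ge0 //.
  by apply: mulr_ge0; rewrite ?addr_ge0 ?[0 <= 4 * _]mulr_ge0 // mulr_ge0 ?sqr_ge0.
(* On average the lower bound is at least (3/4 - 3/16) r = 9/16 r, which exceeds r/2. *)
apply: le_trans (ler_sum _ (fun s _ => absE (walk B s))).
rewrite sumrB -mulr_sumr -mulr_suml walk_sqr rE.
have := walk_pow4 B; rewrite rE; set c : R := 2 ^+ #|I|; set X := \sum_s _ => hX.
have c0 : 0 < c by rewrite exprn_gt0.
have : X / (16 * r ^+ 3) <= c * (3 * r ^+ 2 ^+ 2) / (16 * r ^+ 3).
  by rewrite ler_pM2r // invr_gt0 mulr_gt0 ?exprn_gt0.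
have -> : c * (3 * r ^+ 2 ^+ 2) / (16 * r ^+ 3) = 3 / 16 * (c * r) by field; rewrite gt_eqF.
have -> : 3 / (4 * r) * (c * r ^+ 2) = 3 / 4 * (c * r) by field; rewrite gt_eqF.
have : 0 < c * r by rewrite mulr_gt0.
lra.
Qed.
End Coins.

(** * The cycle and its visits to each pair (state, charged bit) *)

Definition cyclic_mdp (S A : finType) : det_mdp S A :=
  fun s _ => enum_val (ordS (enum_rank s)).

Section Visits.
Variables (S A : finType) (s1 : S).

Definition visit (t : nat) : S := iter t (enum_val \o @ordS _ \o enum_rank) s1.

Lemma state_at_cyclic (choose : nat -> S -> A) (t : nat) :
  state_at (@cyclic_mdp S A) s1 choose t = visit t.
Proof. by elim: t => //= t ->. Qed.

Lemma enum_rank_visit (t : nat) :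
  enum_rank (visit t) = ((enum_rank s1 + t) %% #|S|)%N :> nat.
Proof.
elim: t => [|t IHt]; first by rewrite addn0 modn_small.
by rewrite [visit _]/= enum_valK /= -addn1 IHt modnDml addn1 addnS.
Qed.

Variables (k T : nat).

(** The number of bits is written [k.+1], so that [inord] has an inhabited target. *)
Definition round_bit (t : nat) : 'I_k.+1 := inord ((t %/ #|S|) %% k.+1).

Definition visits (b : S * 'I_k.+1) : {set 'I_T} :=
  [set t : 'I_T | (visit t, round_bit t) == b].

(** Each full period of [#|S| * k.+1] steps contains a step visiting [b]; the injection [f] selects
    it in period [q]. *)
Lemma card_visits (b : S * 'I_k.+1) : (T %/ (#|S| * k.+1) <= #|visits b|)%N.
Proof.
have n0 : (0 < #|S|)%N by apply/card_gt0P; exists s1.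
case: b => s j; set n := #|S| in n0 *; set m := (T %/ _)%N.
(* Position of [s] within a round started at [s1]; adding [n] first keeps the subtraction from
   truncating. *)
pose p := ((enum_rank s + (n - enum_rank s1)) %% n)%N.
have pn : (p < n)%N by rewrite ltn_pmod.
have lt_T (q : 'I_m) : ((q * k.+1 + j) * n + p < T)%N.
  apply: (@leq_trans (m * (n * k.+1))%N); last exact: leq_divM.
  by have := ltn_ord q; have := ltn_ord j; nia.
pose f q := Ordinal (lt_T q).
have f_inj : injective f.
  move=> q q' /(congr1 val) /= /(congr1 (fun x => x %/ n)%N).
  rewrite !divnMDl // divn_small // !addn0 => /addIn /eqP.
  by rewrite eqn_mul2r /= => /eqP /val_inj.
rewrite -[leqLHS]card_ord -(card_imset predT f_inj) subset_leq_card //.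
apply/fintype.subsetP => _ /imsetP[q _ ->]; rewrite inE xpair_eqE; apply/andP; split.
  rewrite -(inj_eq enum_rank_inj) -val_eqE /= enum_rank_visit.
  rewrite addnCA modnMDl modnDmr addnCA subnKC 1?ltnW // modnDr.
  by rewrite modn_small.
rewrite /round_bit -val_eqE /= inordK ?ltn_pmod //.
by rewrite divnMDl // divn_small // addn0 modnMDl modn_small.
Qed.

End Visits.

(** * Coin losses and the policy chosen in hindsight *)

Section CoinLoss.
Variables (R : realType) (S A : finType) (s1 : S) (k T : nat).
Variables (code : A -> {ffun 'I_k.+1 -> bool}).
Variables (decode : {ffun 'I_k.+1 -> bool} -> A).
Hypothesis decodeK : cancel decode code.
Local Notation coins := {ffun 'I_T -> bool}.
Local Notation N := (@cyclic_mdp S A).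
Local Notation visits := (@visits S s1 k T).
Local Notation bit := (@round_bit S k).

(** Losses are indexed by all of [nat] but there are only [T] coins: from [T] on the coin defaults
    to [false]. *)
Definition coin_loss (x : coins) : loss_seq R S A :=
  fun t _ a => (oapp x false (insub t) (+) code a (bit t))%:R.

Lemma coin_loss01 x t s a : 0 <= coin_loss x t s a <= 1.
Proof. by rewrite /coin_loss; case: (_ (+) _); rewrite lexx ler01. Qed.

(** A bit b equals (1 - (-1)^b) / 2, and xor becomes a product of signs. *)
Lemma coin_lossE x (t : 'I_T) s a :
  coin_loss x t s a =
  2^-1 - 2^-1 * ((-1) ^+ x t * (-1) ^+ code a (bit t)).
Proof.
rewrite /coin_loss valK /= -signr_addb.
by case: (_ (+) _); rewrite ?expr1 ?expr0 /=; field.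
Qed.

Lemma coin_loss_flip x (t : 'I_T) :
  mkseq (coin_loss (flip t x)) t = mkseq (coin_loss x) t.
Proof.
apply/eq_in_map => u; rewrite mem_iota add0n => /= ut.
apply/funext => s; apply/funext => a; rewrite /coin_loss.
have uT := ltn_trans ut (ltn_ord t).
by rewrite insubT /= flip_neq // -val_eqE /= ltn_eqF.
Qed.

(** Each bit carries the sign of its walk, so that their product is the absolute value. *)
Definition hindsight (x : coins) : {ffun S -> A} :=
  [ffun s => decode [ffun j => walk R (visits (s, j)) x < 0]].

Lemma policy_loss_hindsight x :
  policy_loss N s1 (coin_loss x) T (hindsight x) =
  T%:R / 2 - 2^-1 * \sum_b `|walk R (visits b) x|.
Proof.
rewrite /policy_loss /total_loss.
under eq_bigr => t _ do rewrite state_at_cyclic coin_lossE ffunE decodeK ffunE.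
rewrite sumrB sumr_const card_ord -[_ *+ T]mulr_natl -mulr_sumr; congr (_ - _ * _).
(* Steps with the same state and charged bit share one bit of the policy, so their coin signs add up
   to a walk. *)
rewrite (partition_big (fun t : 'I_T => (visit s1 t, bit t)) predT) //=.
apply: eq_bigr => b _; rewrite normrEsign /walk mulr_sumr.
apply: eq_big => [t|t /eqP ->]; first by rewrite inE.
by rewrite mulrC; case: b.
Qed.

(** * Expected loss of an arbitrary algorithm, and averaging over the coins *)

Section Algorithm.
Variables (d : measure_display) (Omega : measurableType d).
Variables (P : probability Omega R) (alg : algorithm R S A Omega).

Lemma integrable_affine (f : Omega -> R) (a b : R) :
  P.-integrable [set: Omega] (EFin \o f) ->
  P.-integrable [set: Omega] (fun w => (a - b * f w)%:E).
Proof.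
move=> fi.
rewrite [X in integrable _ _ X](_ : _ =
    (EFin \o cst a) \- (fun w => b%:E * (f w)%:E))%E.
  apply: integrableB => //; first exact: finite_measure_integrable_cst.
  exact: integrableZl.
by apply/funext => w /=; rewrite EFinB EFinM.
Qed.

Lemma integral_affine (f : Omega -> R) (a b : R) :
  P.-integrable [set: Omega] (EFin \o f) ->
  (\int[P]_w (a - b * f w)%:E = (a - b * \int[P]_w f w)%:E)%E.
Proof.
move=> fi; have Pa : (\int[P]_w a%:E = a%:E)%E.
  by have := expectation_cst P a; rewrite unlock.
under eq_integral => w _ do rewrite EFinB EFinM.
rewrite integralB //=.
- rewrite Pa integralZl // EFinB EFinM.
  by rewrite fineK // integrable_fin_num.
- exact: finite_measure_integrable_cst.
- exact: integrableZl.
Qed.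

(** Bounded by 1, and measurable since each preimage is a finite union, over actions, of the events
    in [act_measurable]. *)
Lemma integrable_sign_act (h : seq (S -> A -> R)) (s : S) (f : A -> bool) :
  P.-integrable [set: Omega]
    (EFin \o (fun w => (-1) ^+ f (alg N w h s) : R)).
Proof.
apply: measurable_bounded_integrable => //.
- exact: (le_lt_trans (probability_le1 P measurableT) (ltry _)).
- move=> _ B mB; rewrite setTI.
  have -> : (fun w => (-1) ^+ f (alg N w h s) : R) @^-1` B =
      \bigcup_(a in [set a | B ((-1) ^+ f a : R)]) [set w | alg N w h s = a].
    apply/seteqP; split=> [w Bw|w [a /[swap] /= <-]] //.
    by exists (alg N w h s).
  apply: fin_bigcup_measurable => [|a _]; last exact: act_measurable.
  exact: finite_finset.
- exists 1; split => // M M1 w _.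
  by rewrite /= normr_sign ltW.
Qed.

(** On the cycle the state [visit s1 t] is deterministic; only the action is random. *)
Definition mean_sign (x : coins) (t : 'I_T) : R :=
  \int[P]_w ((-1) ^+ code (alg N w (mkseq (coin_loss x) t) (visit s1 t)) (bit t)).

Lemma expectation_algorithm_loss x :
  ('E_P[algorithm_loss N s1 alg (coin_loss x) T] =
   (T%:R / 2 - 2^-1 * \sum_(t < T) (-1) ^+ x t * mean_sign x t)%:E)%E.
Proof.
have alg_int t := integrable_sign_act (mkseq (coin_loss x) t) (visit s1 t)
  (fun a => code a (bit t)).
pose g (t : 'I_T) w : R := 2^-1 - 2^-1 * (-1) ^+ x t *
  (-1) ^+ code (alg N w (mkseq (coin_loss x) t) (visit s1 t)) (bit t).
have g_int t : P.-integrable [set: Omega] (fun w => (g t w)%:E).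
  exact: integrable_affine.
rewrite unlock; transitivity (\sum_(t < T) \int[P]_w (g t w)%:E)%E.
  rewrite -integral_sum //; apply: eq_integral => w _.
  rewrite sumEFin; congr EFin; apply: eq_bigr => t _.
  by rewrite state_at_cyclic coin_lossE mulrA.
under eq_bigr => t _ do rewrite integral_affine // -mulrA.
by rewrite sumEFin sumrB sumr_const card_ord -[_ *+ T]mulr_natl -mulr_sumr.
Qed.

Lemma sum_mean_sign (t : 'I_T) :
  \sum_(x : coins) (-1) ^+ x t * mean_sign x t = 0.
Proof. by apply: sum_sign_flip => x; rewrite /mean_sign coin_loss_flip. Qed.

Lemma regret_ge (N' : det_mdp S A) (loss : loss_seq R S A) (pi : {ffun S -> A}) :
  ('E_P[algorithm_loss N' s1 alg loss T] - (policy_loss N' s1 loss T pi)%:E <=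
   regret N' s1 P alg loss T)%E.
Proof. by rewrite leeB // bigmin_le. Qed.

Lemma regret_coin_loss : exists x : coins,
  (((#|S| * k.+1)%:R / 4 * Num.sqrt (T %/ (#|S| * k.+1))%:R)%:E <=
   regret N s1 P alg (coin_loss x) T)%E.
Proof.
set B : R := _ / 4 * _.
(* [F x] is the regret against [hindsight x]; its mean over the coins is at least [B]. *)
pose F x : R := 2^-1 * (\sum_b `|walk R (visits b) x| -
                   \sum_(t < T) (-1) ^+ x t * mean_sign x t).
have sumF : 2 ^+ T * B <= \sum_x F x.
  rewrite /F -mulr_sumr sumrB [X in _ - X]exchange_big /=.
  rewrite [X in _ - X]big1 => [|t _]; last exact: sum_mean_sign.
  rewrite subr0 exchange_big /=.
  apply: (@le_trans _ _ (2^-1 * \sum_(b : S * 'I_k.+1)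
      2 ^+ T * (2^-1 * Num.sqrt (T %/ (#|S| * k.+1))%:R))).
    rewrite sumr_const card_prod card_ord -[_ *+ _]mulr_natl /B; lra.
  rewrite ler_pM2l ?invr_gt0 //; apply: ler_sum => b _.
  apply: le_trans (khinchine_L1 R (visits b)); rewrite card_ord.
  by rewrite !ler_pM2l ?exprn_gt0 ?invr_gt0 // ler_wsqrtr // ler_nat card_visits.
have [x BF] : exists x, B <= F x.
  apply: contrapT => /forallNP ltB; move: sumF; apply/negP; rewrite -ltNge.
  have -> : 2 ^+ T * B = \sum_(x : coins) B.
    by rewrite sumr_const card_ffun card_bool card_ord -[B *+ _]mulr_natl natrX.
  apply: ltr_sum => [|x _]; last by rewrite ltNge; apply/negP.
  by apply/hasP; exists [ffun=> false]; rewrite ?mem_index_enum.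
exists x; apply: le_trans (regret_ge _ _ (hindsight x)).
rewrite expectation_algorithm_loss policy_loss_hindsight -EFinB lee_fin.
by apply: le_trans BF _; rewrite /F; lra.
Qed.

End Algorithm.
End CoinLoss.

(** * Bit labels for actions, and the final constants *)

Lemma boolfun_encoding (A : finType) (k : nat) : (2 ^ k <= #|A|)%N ->
  exists code (decode : {ffun 'I_k -> bool} -> A), cancel decode code.
Proof.
move=> kA; pose F := {ffun 'I_k -> bool}.
have cardF : #|F| = (2 ^ k)%N by rewrite card_ffun card_bool card_ord.
have FA : (#|F| <= #|A|)%N by rewrite cardF.
pose decode (f : F) : A := enum_val (widen_ord FA (enum_rank f)).
have decode_inj : injective decode.
  move=> f g /enum_val_inj /(congr1 val) /= fg.
  by apply: enum_rank_inj; apply: val_inj.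
(* Actions outside the image of [decode] receive the all-[false] string. *)
exists (fun a => odflt [ffun=> false] [pick f | decode f == a]), decode => f.
by case: pickP => [g /eqP /decode_inj //|/(_ f)]; rewrite eqxx.
Qed.

Theorem theorem4p7 (R : realType) :
  exists2 c : R, 0 < c &
  forall nS nA : nat, (3 < nS)%N -> (1 <= nA)%N ->
  exists T0 : nat, forall T : nat, (T0 <= T)%N ->
  forall (S A : finType), #|S| = nS -> #|A| = nA ->
  forall (s1 : S) (d : measure_display) (Omega : measurableType d)
    (P : probability Omega R) (alg : algorithm R S A Omega),
  exists (N : det_mdp S A) (loss : loss_seq R S A),
    (forall t s a, 0 <= loss t s a <= 1) /\
    ((c * Num.sqrt (nS%:R * T%:R * ln nA%:R))%:E
      <= regret N s1 P alg loss T)%E.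
Proof.
(* With n = nS (k + 1) and m = floor (T / n), the regret is at least (n / 4) sqrt m, while sqrt (nS
   T ln nA) <= 2 n sqrt m. *)
exists 8^-1; first by rewrite invr_gt0.
move=> nS nA nS3 nA1; have n0 : (0 < nS)%N by exact: ltn_trans nS3.
(* As k + 1 < 2^(k + 1) <= nA, this threshold gives n <= T, hence m >= 1 and T <= 2 m n. *)
exists (nS * nA)%N => T T0 S A cS cA s1 d Omega P alg.
(* A single action leaves no bit to charge, but then ln nA = 0 and zero losses suffice. *)
have [nA_1|nA2] := leqP nA 1.
  exists (@cyclic_mdp S A), (fun _ _ _ => 0); split=> [t s a|].
    by rewrite lexx ler01.
  have -> : nA = 1%N by apply/eqP; rewrite eqn_leq nA_1.
  rewrite ln1 mulr0 sqrtr0 mulr0.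
  have [a _] : exists a, a \in A by apply/card_gt0P; rewrite cA.
  apply: le_trans (regret_ge _ _ _ _ _ _ [ffun=> a]).
  rewrite /policy_loss /algorithm_loss /total_loss.
  by rewrite big1 // sube0 expectation_ge0 // => w; rewrite sumr_ge0.
have [k kE] : exists k, trunc_log 2 nA = k.+1.
  by exists (trunc_log 2 nA).-1; rewrite prednK // trunc_log_gt0.
have /andP[kA Ak] : (2 ^ k.+1 <= nA < 2 ^ k.+2)%N.
  by rewrite -kE; apply: trunc_log_bounds.
have [code [decode decodeK]] : exists code
    (decode : {ffun 'I_k.+1 -> bool} -> A), cancel decode code.
  by apply: boolfun_encoding; rewrite cA.
have [x xP] := regret_coin_loss s1 T decodeK P alg.
exists (@cyclic_mdp S A), (coin_loss R code x); split; first exact: coin_loss01.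
apply: le_trans xP; rewrite lee_fin cS.
set n := (nS * k.+1)%N; set m := (T %/ n)%N.
have n_gt0 : (0 < n)%N by rewrite muln_gt0 n0.
have nT : (n <= T)%N.
  apply: leq_trans T0; rewrite leq_mul2l (leq_trans _ kA) ?orbT //.
  exact/ltnW/ltn_expl.
have m_gt0 : (0 < m)%N by rewrite divn_gt0.
have Tm : (T <= 2 * (m * n))%N.
  by have := ltn_ceil T n_gt0; rewrite -/m mulSn; nia.
(* From nA < 2^(k + 2), ln 2 <= 1 and k + 2 <= 2 (k + 1). *)
have lnA : ln nA%:R <= 2 * k.+1%:R :> R.
  apply: (@le_trans _ _ (ln (2 ^+ k.+2))).
    by rewrite ler_ln ?posrE ?exprn_gt0 ?ltr0n // -natrX ler_nat ltnW.
  rewrite lnXn // -[_ *+ k.+2]mulr_natr.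
  have : ln (1 + 1) <= 1 :> R by apply: le_ln1Dx; lra.
  have : 0 <= k%:R :> R by [].
  rewrite -[k.+2%:R]natr1 -[k.+1%:R]natr1; nra.
have TmR : T%:R <= 2 * (m%:R * n%:R) :> R by rewrite -!natrM ler_nat.
apply: (@le_trans _ _ (8^-1 * Num.sqrt (4 * (n%:R ^+ 2 * m%:R)))).
  rewrite ler_pM2l ?invr_gt0 // ler_wsqrtr //.
  have -> : 4 * (n%:R ^+ 2 * m%:R) =
      nS%:R * (2 * (m%:R * n%:R)) * (2 * k.+1%:R) :> R by rewrite /n natrM; ring.
  apply: ler_pM; rewrite ?mulr_ge0 ?ln_ge0 ?ler1n //.
  by rewrite ler_wpM2l.
have -> : 4 * (n%:R ^+ 2 * m%:R) = (2 * n%:R) ^+ 2 * m%:R :> R by ring.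
by rewrite sqrtrM ?sqr_ge0 // sqrtr_sqr ger0_norm ?mulr_ge0 //; lra.
Qed.
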